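(* Let $f\colon\mathbb{R}^n\to\mathbb{R}$ be continuously differentiable, let $M\subset\mathbb{R}^n$ be closed, and let $K\colon\mathbb{R}^n\rightrightarrows\mathbb{R}^m$ be a set-valued mapping with closed graph. Let $\bar z\in M\cap\operatorname{dom}K$ be a feasible point of $(\mathrm P)$: $\min_z\{f(z)\mid z\in M\cap\operatorname{dom}K\}$, and let $K$ be inner semicompact w.r.t. $\operatorname{dom}K$ at $\bar z$. Then the following hold. (a) If $\bar z$ is implicitly S-stationary, then it is abstractly B-stationary and explicitly S-stationary. (b) $\bar z$ is explicitly S-stationary if and only if it is explicitly S-stationary w.r.t. each $\bar\lambda\in K(\bar z)$. (c) If $\bar z$ is explicitly S-stationary, if $K(\bar z)$ is a singleton, and if $K$ is inner calm* in the fuzzy sense at $\bar z$ w.r.t. $\operatorname{dom}K$, then $\bar z$ is implicitly S-stationary.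
   Context: $\operatorname{gph}K:=\{(z,\lambda)\mid\lambda\in K(z)\}$, $\operatorname{dom}K:=\{z\mid K(z)\neq\emptyset\}$; $\|\cdot\|$ is the Euclidean norm. For $\Omega\subset\mathbb{R}^n$ locally closed around $\bar z\in\Omega$: the tangent cone $T_\Omega(\bar z)$ is the set of all $w$ for which there are $t_k\downarrow0$ (with $t_k>0$) and $w_k\to w$ with $\bar z+t_kw_k\in\Omega$ for all $k$; the regular normal cone is $\widehat N_\Omega(\bar z):=\{\zeta\mid\zeta^\top(z-\bar z)\le o(\|z-\bar z\|)\ \forall z\in\Omega\}$. Regular coderivative: $\widehat D^*K(\bar z,\bar\lambda)(y^* ):=\{x^*\in\mathbb{R}^n\mid(x^*,-y^* )\in\widehat N_{\operatorname{gph}K}(\bar z,\bar\lambda)\}$ for $y^*\in\mathbb{R}^m$. $K$ is inner semicompact w.r.t. $\operatorname{dom}K$ at $\bar z\in\operatorname{dom}K$ if for each sequence $\{z_k\}\subset\operatorname{dom}K$ with $z_k\to\bar z$ there is a sequence $\{\lambda_k\}$ possessing a bounded subsequence such that $\lambda_k\in K(z_k)$ for all $k$. (This together with closedness of $\operatorname{gph}K$ makes $\operatorname{dom}K$ closed locally around $\bar z$.) $K$ is inner calm* in the fuzzy sense w.r.t. $\operatorname{dom}K$ at $\bar z\in\operatorname{dom}K$ if for each $d\in T_{\operatorname{dom}K}(\bar z)$ with $\|d\|=1$ there exist $\kappa_d>0$, $\bar\lambda\in\mathbb{R}^m$, and sequences $t_k\downarrow0$ (with $t_k>0$), $d_k\to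 d$, $\lambda_k\to\bar\lambda$ such that $\lambda_k\in K(\bar z+t_kd_k)$ and $\|\lambda_k-\bar\lambda\|\le\kappa_dt_k\|d_k\|$ for all $k$. Stationarity of $\bar z$: - abstractly B-stationary: $f'(\bar z)w\ge0$ for all $w\in T_{M\cap\operatorname{dom}K}(\bar z)$; - implicitly S-stationary: $-\nabla f(\bar z)\in\widehat N_M(\bar z)+\widehat N_{\operatorname{dom}K}(\bar z)$; - explicitly S-stationary w.r.t. $\bar\lambda\in K(\bar z)$: $-\nabla f(\bar z)\in\widehat N_M(\bar z)+\widehat D^*K(\bar z,\bar\lambda)(0)$; - explicitly S-stationary: the preceding inclusion holds for all $\bar\lambda\in K(\bar z)$. *)

(* Defs.v *)
From HB Require Import structures.
From mathcomp Require Import all_boot all_order all_algebra.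
From mathcomp Require Import all_classical all_reals all_analysis.
Import Order.TTheory GRing.Theory Num.Theory.
Import numFieldNormedType.Exports.

Set Implicit Arguments.
Unset Strict Implicit.
Unset Printing Implicit Defensive.

Local Open Scope classical_set_scope.
Local Open Scope ring_scope.

(* The library norm `|x| on row vectors is the sup norm; it induces the same
   topology as the Euclidean norm enorm, so convergence, closedness and
   differentiability are taken from the library. *)
Definition dotp (R : realType) (n : nat) (x y : 'rV[R]_n) : R :=
  \sum_(i < n) x 0 i * y 0 i.

Definition enorm (R : realType) (n : nat) (x : 'rV[R]_n) : R :=
  Num.sqrt (dotp x x).

Definition set_sum (R : realType) (n : nat) (A B : set 'rV[R]_n) :
  set 'rV[R]_n := [set a + b | a in A & b in B].

Definition gradient (R : realType) (n : nat) (f : 'rV[R]_n -> R)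
  (z : 'rV[R]_n) : 'rV[R]_n := \row_(i < n) 'D_(delta_mx 0 i) f z.

Definition cont_diff (R : realType) (n : nat) (f : 'rV[R]_n -> R) : Prop :=
  (forall z, differentiable f z) /\ continuous (gradient f).

(* Pairs (z, l) of R^n x R^m are encoded as row_mx z l in R^(n + m). *)
Definition gph (R : realType) (n m : nat) (K : 'rV[R]_n -> set 'rV[R]_m) :
  set 'rV[R]_(n + m) := [set v | K (lsubmx v) (rsubmx v)].

Definition dom (R : realType) (n m : nat) (K : 'rV[R]_n -> set 'rV[R]_m) :
  set 'rV[R]_n := [set z | K z !=set0].

Definition tangent_cone (R : realType) (n : nat) (Omega : set 'rV[R]_n)
  (z : 'rV[R]_n) : set 'rV[R]_n :=
  [set w | exists (t : nat -> R) (w_ : nat -> 'rV[R]_n),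
     [/\ forall k, 0 < t k, t @ \oo --> (0 : R), w_ @ \oo --> w
       & forall k, Omega (z + t k *: w_ k)]].

Definition regular_normal_cone (R : realType) (n : nat)
  (Omega : set 'rV[R]_n) (zbar : 'rV[R]_n) : set 'rV[R]_n :=
  [set zeta | forall e : R, 0 < e ->
     \forall z \near zbar, Omega z ->
       dotp zeta (z - zbar) <= e * enorm (z - zbar)].

Definition regular_coderivative (R : realType) (n m : nat)
  (K : 'rV[R]_n -> set 'rV[R]_m) (z : 'rV[R]_n) (lam : 'rV[R]_m)
  (ystar : 'rV[R]_m) : set 'rV[R]_n :=
  [set xstar | regular_normal_cone (gph K) (row_mx z lam)
                 (row_mx xstar (- ystar))].

Definition inner_semicompact (R : realType) (n m : nat)
  (K : 'rV[R]_n -> set 'rV[R]_m) (zbar : 'rV[R]_n) : Prop :=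
  forall z_ : nat -> 'rV[R]_n,
    (forall k, dom K (z_ k)) -> z_ @ \oo --> zbar ->
    exists lam_ : nat -> 'rV[R]_m,
      (forall k, K (z_ k) (lam_ k)) /\
      exists (phi : nat -> nat) (C : R),
        increasing_seq phi /\ forall k, enorm (lam_ (phi k)) <= C.

Definition inner_calm_star_fuzzy (R : realType) (n m : nat)
  (K : 'rV[R]_n -> set 'rV[R]_m) (zbar : 'rV[R]_n) : Prop :=
  forall d : 'rV[R]_n, tangent_cone (dom K) zbar d -> enorm d = 1 ->
    exists (kappa : R) (lambar : 'rV[R]_m) (t : nat -> R)
           (d_ : nat -> 'rV[R]_n) (lam_ : nat -> 'rV[R]_m),
      [/\ 0 < kappa,
          (forall k, 0 < t k) /\ t @ \oo --> (0 : R),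
          d_ @ \oo --> d,
          lam_ @ \oo --> lambar
        & forall k, K (zbar + t k *: d_ k) (lam_ k) /\
            enorm (lam_ k - lambar) <= kappa * t k * enorm (d_ k)].

Definition abstractly_B_stationary (R : realType) (n m : nat)
  (f : 'rV[R]_n -> R) (M : set 'rV[R]_n) (K : 'rV[R]_n -> set 'rV[R]_m)
  (z : 'rV[R]_n) : Prop :=
  forall w, tangent_cone (M `&` dom K) z w -> 0 <= 'd f z w.

Definition implicitly_S_stationary (R : realType) (n m : nat)
  (f : 'rV[R]_n -> R) (M : set 'rV[R]_n) (K : 'rV[R]_n -> set 'rV[R]_m)
  (z : 'rV[R]_n) : Prop :=
  set_sum (regular_normal_cone M z) (regular_normal_cone (dom K) z)
    (- gradient f z).

Definition explicitly_S_stationary_wrt (R : realType) (n m : nat)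
  (f : 'rV[R]_n -> R) (M : set 'rV[R]_n) (K : 'rV[R]_n -> set 'rV[R]_m)
  (z : 'rV[R]_n) (lam : 'rV[R]_m) : Prop :=
  set_sum (regular_normal_cone M z) (regular_coderivative K z lam 0)
    (- gradient f z).

Definition explicitly_S_stationary (R : realType) (n m : nat)
  (f : 'rV[R]_n -> R) (M : set 'rV[R]_n) (K : 'rV[R]_n -> set 'rV[R]_m)
  (z : 'rV[R]_n) : Prop :=
  forall lam, K z lam ->
    set_sum (regular_normal_cone M z) (regular_coderivative K z lam 0)
      (- gradient f z).

(* Main.v *)
Require Import Defs.
From mathcomp Require Import all_boot all_order all_algebra.
From mathcomp Require Import all_classical all_reals all_analysis.
From mathcomp Require Import lra.
Import Order.TTheory GRing.Theory Num.Theory.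
Import numFieldNormedType.Exports.
Set Implicit Arguments.
Unset Strict Implicit.
Unset Printing Implicit Defensive.

Local Open Scope classical_set_scope.
Local Open Scope ring_scope.

(** The two notions of stationarity differ only in which normal cone stands
    next to that of [M]: the normal cone of [dom K], or the slice of the normal
    cone of [gph K] formed by its elements [(zeta, 0)].  So everything reduces to
    comparing these two sets of vectors [zeta].

    Since [(zeta, 0)] does not see the second component and
    [|z - zbar| <= |(z - zbar, lam' - lam)|], a normal to [dom K] always gives a
    normal to [gph K] ([coderivative0_of_normal_dom]); this is the second half
    of (a).  The first half of (a) is the fact that regular normals have
    nonpositive inner product with tangent vectors
    ([regular_normal_tangent_le0]), applied to [M] and to [dom K], whose tangent
    cones both contain that of the intersection.

    For (c) the reverse inclusion is needed ([normal_dom_of_coderivative0]).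
    By compactness of the unit sphere, [zeta] is a regular normal as soon as its
    inner product with every unit tangent vector [d] is nonpositive
    ([regular_normal_of_unit_tangent]).  Fuzzy inner calmness* supplies, for such
    a [d], points [(zbar + t_k d_k, lam_k)] of the graph with [d_k --> d].  The
    limit of [lam_k] belongs to [K zbar] because the graph is closed, hence is
    the only element [lam] of [K zbar], the point where the coderivative is
    taken.  The calmness estimate makes the distance of the graph points to
    [(zbar, lam)] of order [t_k], so the normality of [(zeta, 0)] can be divided
    by [t_k] and yields [dotp zeta d <= e * (1 + kappa) * enorm d] for every
    [e > 0].

    Part (b) holds by definition. *)

(** * Inner product and Euclidean norm *)

Lemma dotpDl (R : realType) (n : nat) (x y z : 'rV[R]_n) :
  dotp (x + y) z = dotp x z + dotp y z.
Proof.
by rewrite /dotp -big_split; apply: eq_bigr => i _; rewrite mxE mulrDl.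
Qed.

Lemma dotpZr (R : realType) (n : nat) (a : R) (x y : 'rV[R]_n) :
  dotp x (a *: y) = a * dotp x y.
Proof. by rewrite /dotp mulr_sumr; apply: eq_bigr => i _; rewrite mxE mulrCA. Qed.

Lemma dotpNl (R : realType) (n : nat) (x y : 'rV[R]_n) :
  dotp (- x) y = - dotp x y.
Proof. by rewrite /dotp -sumrN; apply: eq_bigr => i _; rewrite mxE mulNr. Qed.

Lemma dotp0l (R : realType) (n : nat) (x : 'rV[R]_n) : dotp 0 x = 0.
Proof. by rewrite /dotp big1// => i _; rewrite mxE mul0r. Qed.

Lemma dotp0r (R : realType) (n : nat) (x : 'rV[R]_n) : dotp x 0 = 0.
Proof. by rewrite /dotp big1// => i _; rewrite mxE mulr0. Qed.

Lemma dotpxx_ge0 (R : realType) (n : nat) (x : 'rV[R]_n) : 0 <= dotp x x.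
Proof. by apply: sumr_ge0 => i _; rewrite -expr2 sqr_ge0. Qed.

Lemma enorm_ge0 (R : realType) (n : nat) (x : 'rV[R]_n) : 0 <= enorm x.
Proof. exact: sqrtr_ge0. Qed.

Lemma enorm0 (R : realType) (n : nat) : enorm (0 : 'rV[R]_n) = 0.
Proof. by rewrite /enorm dotp0l sqrtr0. Qed.

Lemma enormZ (R : realType) (n : nat) (a : R) (x : 'rV[R]_n) :
  enorm (a *: x) = `|a| * enorm x.
Proof.
have -> : enorm (a *: x) = Num.sqrt (a ^+ 2 * dotp x x).
  congr Num.sqrt; rewrite /dotp mulr_sumr; apply: eq_bigr => i _.
  by rewrite !mxE expr2 mulrACA.
by rewrite sqrtrM ?sqr_ge0// sqrtr_sqr.
Qed.

Lemma normr_coord_le_enorm (R : realType) (n : nat) (x : 'rV[R]_n) (i : 'I_n) :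
  `|x 0 i| <= enorm x.
Proof.
rewrite -sqrtr_sqr ler_sqrt ?dotpxx_ge0// expr2 /dotp (bigD1 i)//= lerDl.
by apply: sumr_ge0 => j _; rewrite -expr2 sqr_ge0.
Qed.

(** Bounds for the Euclidean norm transfer to the sup norm, in which
    boundedness, hence compactness, is expressed. *)
Lemma normr_le_enorm (R : realType) (n : nat) (x : 'rV[R]_n) :
  `|x| <= enorm x.
Proof.
rewrite [leLHS]/Num.Def.normr /= mx_normrE; apply/bigmax_leP; split=> [|[i j] _ /=].
  exact: enorm_ge0.
by rewrite (ord1 i) normr_coord_le_enorm.
Qed.

Lemma enorm_gt0 (R : realType) (n : nat) (x : 'rV[R]_n) :
  x != 0 -> 0 < enorm x.
Proof. by rewrite -normr_gt0 => /lt_le_trans; apply; exact: normr_le_enorm. Qed.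

Lemma dotp_row_mx (R : realType) (n m : nat) (x u : 'rV[R]_n) (y v : 'rV[R]_m) :
  dotp (row_mx x y) (row_mx u v) = dotp x u + dotp y v.
Proof.
rewrite /dotp big_split_ord /=.
by congr (_ + _); apply: eq_bigr => i _; rewrite ?row_mxEl ?row_mxEr.
Qed.

Lemma enorm_row_mx_le (R : realType) (n m : nat) (x : 'rV[R]_n) (y : 'rV[R]_m) :
  enorm (row_mx x y) <= enorm x + enorm y.
Proof.
have s_ge0 : 0 <= enorm x + enorm y by rewrite addr_ge0 ?enorm_ge0.
rewrite -[leRHS]ger0_norm// -sqrtr_sqr ler_sqrt ?sqr_ge0//.
rewrite dotp_row_mx sqrrD !sqr_sqrtr ?dotpxx_ge0// addrAC lerDl.
by rewrite mulrn_wge0// mulr_ge0 ?enorm_ge0.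
Qed.

Lemma enorm_le_row_mx (R : realType) (n m : nat) (x : 'rV[R]_n) (y : 'rV[R]_m) :
  enorm x <= enorm (row_mx x y).
Proof.
rewrite ler_sqrt ?dotpxx_ge0// dotp_row_mx lerDl; exact: dotpxx_ge0.
Qed.

Lemma dotp_gradient (R : realType) (n : nat) (f : 'rV[R]_n -> R)
    (z w : 'rV[R]_n) :
  differentiable f z -> dotp (gradient f z) w = 'd f z w.
Proof.
move=> fz; rewrite [in RHS](row_sum_delta w) linear_sum.
by apply: eq_bigr => i _; rewrite linearZ/= mxE deriveE// mulrC.
Qed.

(** * Limits of row vectors *)

Lemma cvg_coord (R : realType) (n : nat) (T : Type) (F : set_system T)
    (FF : Filter F) (u : T -> 'rV[R]_n) (x : 'rV[R]_n) (i : 'I_n) :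
  u @ F --> x -> u t 0 i @[t --> F] --> x 0 i.
Proof.
move=> ux; exact: (cvg_comp _ _ ux (@coord_continuous R 1 n 0 i x)).
Qed.

Lemma cvg_dotp (R : realType) (n : nat) (T : Type) (F : set_system T)
    (FF : Filter F) (u v : T -> 'rV[R]_n) (x y : 'rV[R]_n) :
  u @ F --> x -> v @ F --> y -> dotp (u t) (v t) @[t --> F] --> dotp x y.
Proof.
move=> ux vy; apply: (@cvg_big R^o 'I_n +%R 0 xpredT _ T F _
  (fun i t => u t 0 i * v t 0 i) (fun i => x 0 i * y 0 i)) => [|i _].
  by move=> p; exact: (@add_continuous R^o p).
by apply: cvgM; exact: cvg_coord.
Qed.

Lemma cvg_enorm (R : realType) (n : nat) (T : Type) (F : set_system T)
    (FF : Filter F) (u : T -> 'rV[R]_n) (x : 'rV[R]_n) :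
  u @ F --> x -> enorm (u t) @[t --> F] --> enorm x.
Proof.
move=> ux; exact: (cvg_comp _ _ (cvg_dotp FF ux ux) (@sqrt_continuous R (dotp x x))).
Qed.

(** Neighborhoods of a row vector are given entrywise, and there are finitely
    many entries to intersect over. *)
Lemma cvg_rV (R : realType) (n : nat) (T : Type) (F : set_system T)
    (FF : Filter F) (u : T -> 'rV[R]_n) (x : 'rV[R]_n) :
  (forall i, u t 0 i @[t --> F] --> x 0 i) -> u @ F --> x.
Proof.
move=> ux A /= [P Px PA].
suff : \forall t \near F, forall j, P 0 j (u t 0 j).
  by apply: filterS => t Pt; apply: PA => i j; rewrite (ord1 i).
by apply: filter_forall => j; exact: ux (Px 0 j).
Qed.

Lemma cvg_row_mx (R : realType) (n m : nat) (T : Type) (F : set_system T)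
    (FF : Filter F) (u : T -> 'rV[R]_n) (v : T -> 'rV[R]_m)
    (x : 'rV[R]_n) (y : 'rV[R]_m) :
  u @ F --> x -> v @ F --> y -> row_mx (u t) (v t) @[t --> F] --> row_mx x y.
Proof.
move=> ux vy; apply: cvg_rV => i.
case: (split_ordP i) => k ->.
  rewrite row_mxEl; under eq_cvg do rewrite row_mxEl.
  exact: cvg_coord.
rewrite row_mxEr; under eq_cvg do rewrite row_mxEr.
exact: cvg_coord.
Qed.

Lemma lsubmx_continuous (R : realType) (n m : nat) :
  continuous (@lsubmx R 1 n m).
Proof.
move=> v; apply: (cvg_rV (nbhs_filter v)) => i.
rewrite mxE; under eq_cvg do rewrite mxE.
exact: coord_continuous.
Qed.

Lemma cvg_base_addZ (R : realType) (n : nat) (z d : 'rV[R]_n) (t : nat -> R)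
    (d_ : nat -> 'rV[R]_n) :
  t @ \oo --> (0 : R) -> d_ @ \oo --> d -> z + t k *: d_ k @[k --> \oo] --> z.
Proof.
move=> t0 dd; rewrite -[X in _ --> X]addr0 -(scale0r d).
by apply: cvgD; [exact: cvg_cst|exact: cvgZ].
Qed.

(** * Regular normals and tangent directions *)

(** For positive [x] the hypothesis at [e = 1] forces [c] to be positive, and
    then [e = x / (2 * c)] gives [x <= x / 2]. *)
Lemma le0_epsilonM (R : realType) (x c : R) :
  (forall e, 0 < e -> x <= e * c) -> x <= 0.
Proof.
move=> xc; rewrite leNgt; apply/negP => x0.
have c0 : 0 < c by have := lt_le_trans x0 (xc 1 ltr01); rewrite mul1r.
have := xc (x / 2 / c); rewrite !divr_gt0// divfK ?gt_eqF// => /(_ isT).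
by lra.
Qed.

(** The [o]-estimate at [z + t_k w_k] is homogeneous in [t_k]; dividing by
    [t_k] and letting [k] grow leaves [dotp zeta w <= e * enorm w]. *)
Lemma regular_normal_tangent_le0 (R : realType) (n : nat)
    (Omega : set 'rV[R]_n) (z zeta w : 'rV[R]_n) :
  regular_normal_cone Omega z zeta -> tangent_cone Omega z w ->
  dotp zeta w <= 0.
Proof.
move=> Nzeta [t [w_ [t_gt0 t0 ww tw_Omega]]].
apply: (@le0_epsilonM _ _ (enorm w)) => e e0.
apply: (@ler_cvg_to _ \oo _ _ (fun k => dotp zeta (w_ k))
  (fun k => e * enorm (w_ k))).
- by apply: cvg_dotp => //; exact: cvg_cst.
- by apply: cvgMr; exact: cvg_enorm.
- have := cvg_base_addZ (z := z) t0 ww (Nzeta e e0).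
  apply: (@filterS _ \oo) => k /(_ (tw_Omega k)).
  rewrite addrAC subrr add0r dotpZr enormZ gtr0_norm//.
  by rewrite mulrCA ler_pM2l.
Qed.

Lemma cvg_harmonic_ball (R : realType) (n : nat) (u : nat -> 'rV[R]_n)
    (x : 'rV[R]_n) :
  (forall k, ball x (k.+1%:R^-1) (u k)) -> u @ \oo --> x.
Proof.
move=> xu; apply/cvg_ballP => r r0.
have harm_lt : \forall k \near \oo, harmonic k < r.
  exact: (cvgr_lt _ (@cvg_harmonic R) _ r0).
by apply: filterS harm_lt => k /ltW kr; exact: le_ball kr _ (xu k).
Qed.

(** If the [o]-estimate fails for some [e], then [z] is a limit of points of
    [Omega] at which it is violated.  Their normalized directions from [z]
    accumulate at a unit tangent vector [d], and the violated estimates give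
    [dotp zeta d >= e] in the limit. *)
Lemma regular_normal_of_unit_tangent (R : realType) (n : nat)
    (Omega : set 'rV[R]_n) (z zeta : 'rV[R]_n) :
  (forall d, tangent_cone Omega z d -> enorm d = 1 -> dotp zeta d <= 0) ->
  regular_normal_cone Omega z zeta.
Proof.
move=> zeta_le0 e e0.
pose Bad := [set y | Omega y /\ e * enorm (y - z) < dotp zeta (y - z)].
suff : ~ (closure Bad z).
  move=> nBad; have [P [zP PBad]] : exists P, nbhs z P /\ ~ (Bad `&` P !=set0).
    apply: contrapT => H; apply: nBad => P zP; apply: contrapT => BP.
    by apply: H; exists P.
  apply: filterS zP => y Py Oy; rewrite leNgt; apply/negP => ylt.
  by apply: PBad; exists y.
move=> Bad_z.
pose dir (y : 'rV[R]_n) : 'rV[R]_n := (enorm (y - z))^-1 *: (y - z).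
(* Directions of the violating points that are arbitrarily close to [z]. *)
pose F := filter_from (nbhs z) (fun P => dir @` (Bad `&` P)).
have FF : ProperFilter F.
  apply: filter_from_proper => [|P zP].
    apply: filter_from_filter; first by exists setT; exact: filterT.
    move=> P Q zP zQ; exists (P `&` Q); first exact: filterI.
    by move=> _ [y [By [Py Qy]] <-]; split; exists y.
  by have [y By] := Bad_z _ zP; exists (dir y); exists y.
have Bad_gt0 y : Bad y -> 0 < enorm (y - z).
  move=> [_ lt_y]; apply: enorm_gt0; apply: contraTneq lt_y => ->.
  by rewrite dotp0r enorm0 mulr0 ltxx.
have dir1 y : Bad y -> enorm (dir y) = 1.
  move=> /Bad_gt0 y0; rewrite enormZ gtr0_norm ?invr_gt0// mulVf//.
  by rewrite gt_eqF.
have sphere_closed : closed [set d : 'rV[R]_n | enorm d = 1].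
  apply: (@closed_comp _ _ (@enorm R n) [set 1]) => [x _|]; last exact: closed_eq.
  exact: (cvg_enorm (nbhs_filter x) (@cvg_id _ (nbhs x))).
have sphere_compact : compact [set d : 'rV[R]_n | enorm d = 1].
  apply: bounded_closed_compact => //.
  exists 1; split; first exact: num_real.
  by move=> c c1 d /= d1; apply/ltW/(le_lt_trans _ c1); rewrite -d1 normr_le_enorm.
have [d [d1 Fd]] : [set d : 'rV[R]_n | enorm d = 1] `&` cluster F !=set0.
  apply: sphere_compact; exists setT; first exact: filterT.
  by move=> _ [y [By _] <-]; exact: dir1.
(* An accumulation point of the directions along the neighborhoods of [z]
   provides a sequence whose points and directions converge together. *)
have near_d (k : nat) : exists y, [/\ Bad y, ball z (k.+1%:R^-1) y
    & ball d (k.+1%:R^-1) (dir y)].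
  have k0 : 0 < k.+1%:R^-1 :> R by rewrite invr_gt0.
  have F_near : F (dir @` (Bad `&` ball z (k.+1%:R^-1))).
    by exists (ball z (k.+1%:R^-1)); first exact: nbhsx_ballx.
  have [_ [[y [By zy] <-] dy]] := Fd _ _ F_near (nbhsx_ballx d _ k0).
  by exists y.
have [y_ y_P] := choice near_d.
have dir_y : dir \o y_ @ \oo --> d by apply: cvg_harmonic_ball => k; case: (y_P k).
have y_z : y_ @ \oo --> z by apply: cvg_harmonic_ball => k; case: (y_P k).
have Td : tangent_cone Omega z d.
  exists (fun k => enorm (y_ k - z)), (dir \o y_); split => //.
  - by move=> k; apply: Bad_gt0; case: (y_P k).
  - rewrite -(enorm0 R n).
    by apply: cvg_enorm; rewrite -(subrr z); apply: cvgB => //; exact: cvg_cst.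
  - move=> k; have [By _ _] := y_P k.
    rewrite /dir /= scalerA divff ?gt_eqF ?Bad_gt0// scale1r addrC subrK.
    by case: By.
have : e <= dotp zeta d.
  have dot_d : dotp zeta (dir (y_ k)) @[k --> \oo] --> dotp zeta d.
    by apply: cvg_dotp => //; exact: cvg_cst.
  apply: (ler_cvg_to (cvg_cst e) dot_d).
  near=> k; have [By _ _] := y_P k.
  rewrite dotpZr mulrC ler_pdivlMr ?Bad_gt0//; apply/ltW; by case: By.
by move=> /(lt_le_trans e0); rewrite ltNge zeta_le0.
Unshelve. all: by end_near. Qed.

(** * Normals to the graph and normals to the domain *)

(** Projecting the graph onto the domain decreases distances and leaves the
    inner product with [(zeta, 0)] unchanged. *)
Lemma coderivative0_of_normal_dom (R : realType) (n m : nat)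
    (K : 'rV[R]_n -> set 'rV[R]_m) (z zeta : 'rV[R]_n) (lam : 'rV[R]_m) :
  regular_normal_cone (dom K) z zeta -> regular_coderivative K z lam 0 zeta.
Proof.
move=> Nzeta e e0.
have zl : lsubmx v @[v --> row_mx z lam] --> z.
  by rewrite -[X in _ --> X](row_mxKl z lam); exact: lsubmx_continuous.
have := zl _ (Nzeta e e0); apply: (@filterS _ (nbhs (row_mx z lam))) => v /= H Kv.
have -> : v - row_mx z lam = row_mx (lsubmx v - z) (rsubmx v - lam).
  by rewrite -[in LHS](hsubmxK v) opp_row_mx add_row_mx.
rewrite dotp_row_mx oppr0 dotp0l addr0.
apply: le_trans (H _) _; first by exists (rsubmx v).
by rewrite ler_pM2l ?enorm_le_row_mx.
Qed.

(** Calmness keeps [lam_k - lam] of order [t_k], the order of the step in the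
    domain; without it the [o]-term of the graph could dominate the inner product
    of [zeta] with the step. *)
Lemma normal_dom_of_coderivative0 (R : realType) (n m : nat)
    (K : 'rV[R]_n -> set 'rV[R]_m) (z zeta : 'rV[R]_n) (lam : 'rV[R]_m) :
  closed (gph K) -> K z = [set lam] -> inner_calm_star_fuzzy K z ->
  regular_coderivative K z lam 0 zeta -> regular_normal_cone (dom K) z zeta.
Proof.
move=> Kclosed Kz calm Dzeta; apply: regular_normal_of_unit_tangent => d Td d1.
have [c [l [t [d_ [l_ [c0 [t_gt0 t0] dd ll KP]]]]]] := calm d Td d1.
have vcvg := cvg_row_mx eventually_filter (cvg_base_addZ (z := z) t0 dd) ll.
(* The limit of [l_] belongs to [K z] since the graph is closed, so it is [lam]. *)
have : gph K (row_mx z l).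
  apply: (closed_cvg (gph K) Kclosed _ _ vcvg); apply: nearW => k.
  by rewrite /gph /= row_mxKl row_mxKr; case: (KP k).
rewrite /gph /= row_mxKl row_mxKr Kz /= => l_lam.
rewrite {}l_lam in ll vcvg KP.
apply: (@le0_epsilonM _ _ ((1 + c) * enorm d)) => e e0.
apply: (@ler_cvg_to _ \oo _ _ (fun k => dotp zeta (d_ k))
  (fun k => e * ((1 + c) * enorm (d_ k)))).
- by apply: cvg_dotp => //; exact: cvg_cst.
- by do 2!apply: cvgMr; exact: cvg_enorm.
- have := vcvg _ (Dzeta e e0); apply: (@filterS _ \oo) => k.
  have [Kk l_le] := KP k.
  rewrite /gph /= row_mxKl row_mxKr => /(_ Kk).
  rewrite opp_row_mx add_row_mx oppr0 dotp_row_mx.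
  rewrite dotp0l addr0 addrAC subrr add0r dotpZr => le_k.
  (* The length of the step in the graph is at most [t_k * (1 + c) * enorm d_k]. *)
  rewrite -(ler_pM2l (t_gt0 k)); apply: le_trans le_k _.
  rewrite mulrCA ler_pM2l//; apply: le_trans (enorm_row_mx_le _ _) _.
  rewrite enormZ gtr0_norm// mulrDl mul1r mulrDr lerD2l mulrCA mulrA.
  exact: l_le.
Qed.

Theorem theorem4p12 (R : realType) (n m : nat) (f : 'rV[R]_n -> R)
  (M : set 'rV[R]_n) (K : 'rV[R]_n -> set 'rV[R]_m) (zbar : 'rV[R]_n)
  (f_C1 : cont_diff f) (M_closed : closed M) (gphK_closed : closed (gph K))
  (zbar_feasible : (M `&` dom K) zbar)
  (K_semicompact : inner_semicompact K zbar) :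
  [/\ implicitly_S_stationary f M K zbar ->
        abstractly_B_stationary f M K zbar /\
        explicitly_S_stationary f M K zbar,
      explicitly_S_stationary f M K zbar <->
        (forall lam, K zbar lam -> explicitly_S_stationary_wrt f M K zbar lam)
    & explicitly_S_stationary f M K zbar ->
      (exists lam, K zbar = [set lam]) ->
      inner_calm_star_fuzzy K zbar ->
        implicitly_S_stationary f M K zbar].
Proof.
split=> [[a Na [b Nb ab]]|//|E [lam Klam] calm].
- split=> [w [t [w_ [t_gt0 t0 ww tw]]]|lam _]; last first.
    by exists a => //; exists b => //; exact: coderivative0_of_normal_dom.
  have a0 : dotp a w <= 0.
    apply: regular_normal_tangent_le0 Na _.
    by exists t, w_; split => // k; case: (tw k).
  have b0 : dotp b w <= 0.
    apply: regular_normal_tangent_le0 Nb _.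
    by exists t, w_; split => // k; case: (tw k).
  rewrite -dotp_gradient; last by case: f_C1.
  by rewrite -oppr_le0 -dotpNl -ab dotpDl; lra.
- have [|a Na [b Db ab]] := E lam; first by rewrite Klam.
  exists a => //; exists b => //.
  exact: normal_dom_of_coderivative0 gphK_closed Klam calm Db.
Qed.
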